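(* Let $m \ge 1$ and let $\mathscr{H}_1,\dots,\mathscr{H}_m$ be null hypotheses, each of which is (deterministically) either true or false, with $m_0$ of them true and $m_1 = m - m_0$ of them false, and set $\pi_1 = m_1/m$. Let $p_1,\dots,p_m$ be the corresponding P-values, i.e. $[0,1]$-valued random variables on a common probability space. Let $\alpha\in[0,1]$ and $\beta\in[0,1]$ be such that each test has power $1-\beta$ at level $\alpha$: $p_i$ is uniformly distributed on $[0,1]$ whenever $\mathscr{H}_i$ is true, and $\mathbb{P}(p_i \le \alpha) = 1-\beta$ whenever $\mathscr{H}_i$ is false. Assume $(1-\beta)\pi_1 + \alpha(1-\pi_1) > 0$. Then $$\mathsf{PPV} = 1 - \mathsf{mFDR},$$ where $$\mathsf{PPV} = \frac{(1-\beta)\pi_1}{(1-\beta)\pi_1 + \alpha(1-\pi_1)}$$ and $\mathsf{mFDR}$ is the marginal false discovery rate of the $\alpha$-threshold multiple test, which rejects exactly the hypotheses $\mathscr{H}_i$ with $i \in \mathcal{R}_\alpha = \{i : p_i \le \alpha\}$.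
   Context: A multiple test is a function of the P-values $p_1,\dots,p_m$ returning a (random) index set $\mathcal{R}\subset\{1,\dots,m\}$; the hypothesis $\mathscr{H}_i$ is rejected if and only if $i\in\mathcal{R}$. For a multiple test, let $R = |\mathcal{R}|$ be the total number of rejections and let $V$ be the number of $i\in\mathcal{R}$ such that $\mathscr{H}_i$ is true (the number of rejected true nulls). The marginal false discovery rate of the multiple test is $\mathsf{mFDR} = \mathbb{E}(V)/\mathbb{E}(R)$. *)

(* Defs.v *)
From HB Require Import structures.
From mathcomp Require Import all_boot all_order all_algebra.
From mathcomp Require Import all_classical all_reals all_analysis.

Set Implicit Arguments.
Unset Strict Implicit.
Unset Printing Implicit Defensive.

Import Order.TTheory GRing.Theory Num.Theory.
Import numFieldNormedType.Exports.

Local Open Scope classical_set_scope.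
Local Open Scope ring_scope.

(* Throughout, [H0 : {set 'I_m}] is the deterministic set of (indices of) true
   null hypotheses. *)

Definition multiple_test (R : realType) (m : nat) : Type :=
  ('I_m -> R) -> {set 'I_m}.

Definition threshold_test (R : realType) (m : nat) (alpha : R) :
    multiple_test R m :=
  fun q => [set i | q i <= alpha]%SET.

Section MultipleTesting.
Context (R : realType) (d : measure_display) (T : measurableType d).
Context (P : probability T R) (m : nat).

Definition rejected (p : 'I_m -> {RV P >-> R}) (test : multiple_test R m)
    (t : T) : {set 'I_m} :=
  test (fun i => p i t).

Definition num_rejected (p : 'I_m -> {RV P >-> R}) (test : multiple_test R m)
    (t : T) : R :=
  #|rejected p test t|%:R.

Definition num_false_discoveries (p : 'I_m -> {RV P >-> R})
    (test : multiple_test R m) (H0 : {set 'I_m}) (t : T) : R :=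
  #|rejected p test t :&: H0|%:R.

(* The quotient is taken in the extended reals, where ['E_P] takes its values;
   both expectations lie in [0, m]. *)
Definition mFDR (p : 'I_m -> {RV P >-> R}) (test : multiple_test R m)
    (H0 : {set 'I_m}) : \bar R :=
  ('E_P[num_false_discoveries p test H0] / 'E_P[num_rejected p test])%E.

(* The laws are compared on measurable sets only: the library's measures are
   functions on all sets, with no meaningful values on non-measurable ones. *)
Definition uniform01 (X : {RV P >-> R}) : Prop :=
  forall A : set R, measurable A ->
    distribution P X A = uniform_prob (@ltr01 R) A.

End MultipleTesting.

Definition PPV (R : realType) (pi1 alpha beta : R) : R :=
  ((1 - beta) * pi1) / ((1 - beta) * pi1 + alpha * (1 - pi1)).

(* Main.v *)
Require Import Defs.
From HB Require Import structures.
From mathcomp Require Import all_boot all_order all_algebra.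
From mathcomp Require Import all_classical all_reals all_analysis.
From mathcomp Require Import measurable_realfun ring.

Import Order.TTheory GRing.Theory Num.Theory.
Import numFieldNormedType.Exports.

Local Open Scope classical_set_scope.
Local Open Scope ring_scope.

(** By linearity of expectation, the expected number of rejections inside a fixed set of hypotheses
    is the sum of their individual rejection probabilities, whatever the joint law of the P-values
    ([expectation_card_rejected]). A true null is rejected with probability [alpha]
    ([uniform_prob01_le]), a false one with probability [1 - beta]. Hence E(V) = m0 alpha and E(R) =
    m0 alpha + m1 (1 - beta); cancelling m turns E(V)/E(R) into alpha (1 - pi1) over the denominator
    of [PPV], and its complement to 1 is [PPV]. *)

Lemma uniform_prob01_le (R : realType) (alpha : R) : 0 <= alpha <= 1 ->
  uniform_prob (@ltr01 R) `]-oo, alpha] = alpha%:E.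
Proof.
move=> /andP[a0 a1]; rewrite /uniform_prob integral_uniform_pdf.
have -> : `]-oo, alpha] `&` `[0, 1] = `[0, alpha]%classic :> set R.
  apply/seteqP; split=> x /=; rewrite !in_itv /=.
    by move=> [-> /andP[-> _]].
  by move=> /andP[x0 xa]; rewrite xa x0 (le_trans xa a1).
rewrite (eq_integral (cst 1%:E)); last first.
  move=> x; rewrite inE /= in_itv /= => /andP[x0 xa].
  by rewrite /uniform_pdf x0 (le_trans xa a1) subr0 invr1.
rewrite integral_cst //= lebesgue_measure_itv /= lte_fin mul1e.
(* The length formula is conditional on [0 < alpha]; otherwise [alpha] is 0, and so is the
   measure. *)
case: ifPn => [_|]; first by rewrite sube0.
by rewrite -leNgt => a_le0; congr EFin; apply/eqP; rewrite eq_le a0.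
Qed.

(** The count is a sum of indicators of the events [p i t <= alpha], integrated term by term.
    Leaving [S] arbitrary covers both V ([S] is [H0]) and R ([S] is the full set). *)
Lemma expectation_card_rejected (R : realType) (d : measure_display)
    (T : measurableType d) (P : probability T R) (m : nat)
    (p : 'I_m -> {RV P >-> R}) (alpha : R) (S : {set 'I_m}) :
  ('E_P[fun t => #|rejected p (threshold_test alpha) t :&: S|%:R%R] =
   \sum_(i in S) P [set t | (p i t <= alpha)%R])%E.
Proof.
have m_le i : measurable [set t | p i t <= alpha].
  have := @measurable_funPTI _ _ _ _ (p i) _ (measurable_itv `]-oo, alpha]).
  by congr measurable; apply/seteqP; split=> t /=; rewrite in_itv.
rewrite unlock.
under eq_integral => t _.
  (* Summing over the list [enum S] gives the unfiltered sum that [ge0_integral_sum] handles. *)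
  have -> : #|rejected p (threshold_test alpha) t :&: S|%:R%:E =
      (\sum_(i <- enum S) (\1_[set t | (p i t <= alpha)%R] t)%:E)%E :> \bar R.
    rewrite sumEFin big_enum -natr_sum -sum1_card big_mkcond [in RHS]big_mkcond.
    congr (_%:R%:E); apply: eq_bigr => i _.
    rewrite /= /rejected /threshold_test finset.in_setI finset.inE.
    have -> : (t \in [set t | p i t <= alpha]) = (p i t <= alpha) by exact: asboolb.
    by rewrite andbC; case: (i \in S); case: (p i t <= alpha).
  over.
rewrite ge0_integral_sum //; last first.
  by move=> i; apply/measurable_EFinP; exact: measurable_indic.
rewrite big_enum; apply: eq_bigr => i _.
by rewrite integral_indic // setIT.
Qed.

Theorem proposition2 (R : realType) (d : measure_display)
    (T : measurableType d) (P : probability T R)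
    (m m0 m1 : nat) (m_ge1 : (1 <= m)%N)
    (H0 : {set 'I_m}) (hm0 : #|H0| = m0) (hm1 : m1 = (m - m0)%N)
    (pi1 : R) (hpi1 : pi1 = m1%:R / m%:R)
    (p : 'I_m -> {RV P >-> R})
    (p01 : forall (i : 'I_m) (t : T), 0 <= p i t <= 1)
    (alpha beta : R)
    (alpha01 : 0 <= alpha <= 1) (beta01 : 0 <= beta <= 1)
    (p_true : forall i : 'I_m, i \in H0 -> uniform01 (p i))
    (p_false : forall i : 'I_m, i \notin H0 ->
      P [set t | p i t <= alpha] = (1 - beta)%:E)
    (denom_gt0 : 0 < (1 - beta) * pi1 + alpha * (1 - pi1)) :
  (PPV pi1 alpha beta)%:E = (1 - mFDR p (threshold_test alpha) H0)%E.
Proof.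
have PH0 i : i \in H0 -> P [set t | p i t <= alpha] = alpha%:E.
  by move=> iH0; rewrite -uniform_prob01_le // -(p_true i) //.
have EV : ('E_P[num_false_discoveries p (threshold_test alpha) H0] =
    (m0%:R * alpha)%:E)%E.
  rewrite expectation_card_rejected (eq_bigr (fun=> alpha%:E)) //.
  by rewrite sumEFin sumr_const hm0 mulr_natl.
have ER : ('E_P[num_rejected p (threshold_test alpha)] =
    (m0%:R * alpha + m1%:R * (1 - beta))%:E)%E.
  have -> : num_rejected p (threshold_test alpha) =
      fun t => #|rejected p (threshold_test alpha) t :&: [set: 'I_m]%SET|%:R.
    by apply/funext => t; rewrite finset.setIT.
  rewrite expectation_card_rejected (bigID (mem H0)) /= EFinD; congr (_ + _)%E.
    rewrite (eq_bigl (mem H0)); last by move=> i; rewrite inE.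
    rewrite (eq_bigr (fun=> alpha%:E)) //.
    by rewrite sumEFin sumr_const hm0 mulr_natl.
  rewrite (eq_bigl (mem (~: H0)%SET)); last by move=> i; rewrite !inE.
  rewrite (eq_bigr (fun=> (1 - beta)%:E)); last first.
    by move=> i; rewrite /= inE => /p_false.
  by rewrite sumEFin sumr_const cardsCs finset.setCK card_ord hm0 -hm1 mulr_natl.
have m_neq0 : m%:R != 0 :> R by rewrite pnatr_eq0 -lt0n.
(* This bound makes the truncated difference [m - m0] commute with the cast to [R]. *)
have m0_le : (m0 <= m)%N by rewrite -hm0 -[leqRHS]card_ord max_card.
have m0E : m0%:R = m%:R * (1 - pi1).
  by rewrite hpi1 mulrBr mulr1 mulrCA divff // mulr1 hm1 natrB // subKr.
have m1E : m1%:R = m%:R * pi1 by rewrite hpi1 mulrCA divff // mulr1.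
have denomE : m0%:R * alpha + m1%:R * (1 - beta) =
    m%:R * ((1 - beta) * pi1 + alpha * (1 - pi1)).
  by rewrite m0E m1E; ring.
have denom_neq0 := lt0r_neq0 denom_gt0.
(* E(R) is nonzero, so the extended inverse given by [inver] is the real one. *)
rewrite /mFDR EV ER denomE inver mulf_eq0 (negbTE m_neq0) (negbTE denom_neq0) /=.
rewrite -EFinD /PPV m0E; congr EFin.
by field; rewrite m_neq0 denom_neq0.
Qed.
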